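(* Let $n\ge 3$ and $r\ge 1$ be integers. With respect to the layer-by-layer ordering $V(\Gamma_{n,r}) = V_{n,r}^{(0)} \sqcup V_{n,r}^{(1)} \sqcup \cdots \sqcup V_{n,r}^{(n-1)}$, the matrix $B_{n,r}$ has the block form $$B_{n,r}=\begin{bmatrix} 0 & B_{n,r}^{(0)} & 0 & \cdots & 0 & 0\\ 0 & 0 & B_{n,r}^{(1)} & \cdots & 0 & 0\\ \vdots & \vdots & \ddots & \ddots & \vdots & \vdots\\ 0 & 0 & \cdots & 0 & B_{n,r}^{(n-3)} & 0\\ 0 & 0 & \cdots & 0 & 0 & B_{n,r}^{(n-2)}\\ B_{n,r}^{(n-1)} & 0 & \cdots & 0 & 0 & 0 \end{bmatrix},$$ where $B_{n,r}^{(c)}$ encodes the edges from $V_{n,r}^{(c)}$ to $V_{n,r}^{(c+1)}$ (indices modulo $n$).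
   Context: For integers $n\ge3$ and $r\ge1$, the digraph $\Gamma_{n,r}$ has vertex set $V(\Gamma_{n,r})=\{1,2,\dots,rn-2r+2\}$ and directed edge set $E(\Gamma_{n,r})$ defined by $E(\Gamma_{n,1})=\{(j,j+1):1\le j\le n-1\}\cup\{(n,1)\}$; $E(\Gamma_{n,2})=E(\Gamma_{n,1})\cup\{(1,n+1)\}\cup\{(j,j+1):n+1\le j\le 2n-3\}\cup\{(2n-2,n)\}$; and for $r\ge3$, $E(\Gamma_{n,r})=E(\Gamma_{n,2})\cup\bigcup_{i=1}^{r-2}F_i$, where $F_i=\{(in-2i+2,\,in+n-2i+1)\}\cup\{(j,j+1):in+n-2i+1\le j\le in+2n-2i-3\}\cup\{(in+2n-2i-2,\,in+n-2i)\}$. (For $n=3$ the middle path parts are empty.) The adjacency matrix $A_{n,r}$ is the $(0,1)$-matrix indexed by $V(\Gamma_{n,r})$ whose $(u,v)$-entry is $1$ if and only if $(u,v)\in E(\Gamma_{n,r})$. Layers: define $\ell:V(\Gamma_{n,r})\to\mathbb Z/n\mathbb Z$ along this recursive construction (edges being added in the order in which they are listed above) by $\ell(1)=0$ and, whenever a vertex $v\ne1$ appears for the first time as the terminal vertex of a newly added edge $(u,v)$, $\ell(v)\equiv\ell(u)+1 \pmod n$. For $c\in\mathbb Z/n\mathbb Z$ set $V^{(c)}_{n,r}=\{v\in V(\Gamma_{n,r}):\ell(v)\equiv c \pmod n\}$. Let $S_{n,r}$ be the permutation matrix corresponding to listing the vertices layer by layer: first all vertices of $V^{(0)}_{n,r}$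 in increasing order, then those of $V^{(1)}_{n,r}$ in increasing order, and so on up to $V^{(n-1)}_{n,r}$. Set $B_{n,r}=S_{n,r}A_{n,r}S_{n,r}^{-1}$, i.e. the adjacency matrix in this order. ''Encodes the edges'' means: $B_{n,r}^{(c)}$ is the $(0,1)$-matrix with rows indexed by $V^{(c)}_{n,r}$ and columns by $V^{(c+1)}_{n,r}$ (each in increasing order), with $(u,v)$-entry $1$ if and only if $(u,v)\in E(\Gamma_{n,r})$. *)

(* Defs.v *)
From HB Require Import structures.
From mathcomp Require Import all_boot all_order all_algebra all_fingroup.

Set Implicit Arguments.
Unset Strict Implicit.
Unset Printing Implicit Defensive.

Import GRing.Theory.
Local Open Scope ring_scope.

(* The edges of Gamma_{n,r} are kept as a list, in the order in which the     *)
(* recursive construction adds them. All differences are exact for 3 <= n.    *)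

Definition edges1 (n : nat) : seq (nat * nat) :=
  [seq (j, j.+1) | j <- index_iota 1 n] ++ [:: (n, 1)].

Definition edges2 (n : nat) : seq (nat * nat) :=
  (1, n + 1)%N
    :: [seq (j, j.+1) | j <- index_iota (n + 1)%N (2 * n - 3).+1%N]
    ++ [:: (2 * n - 2, n)%N].

Definition edgesF (n i : nat) : seq (nat * nat) :=
  (i * n - 2 * i + 2, i * n + n - 2 * i + 1)%N
    :: [seq (j, j.+1) |
         j <- index_iota (i * n + n - 2 * i + 1)%N
                         (i * n + 2 * n - 2 * i - 3).+1%N]
    ++ [:: (i * n + 2 * n - 2 * i - 2, i * n + n - 2 * i)%N].

Definition gamma_edges (n r : nat) : seq (nat * nat) :=
  edges1 n
    ++ (if (2 <= r)%N then edges2 n else [::])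
    ++ flatten [seq edgesF n i | i <- index_iota 1 (r - 2).+1%N].

(* Vertices are numbered from 1, so the ordinal v stands for vertex v.+1. *)
Definition vertex (n r : nat) : finType := 'I_(r * n - 2 * r + 2).

Definition gamma_edge (n r : nat) : rel (vertex n r) :=
  [rel u v : vertex n r | (u.+1, v.+1) \in gamma_edges n r].

Definition gamma_adj (n r : nat) : 'M[int]_(r * n - 2 * r + 2) :=
  \matrix_(u, v) (gamma_edge u v)%:R.

(* Partial labellings: None means that the vertex has not been reached yet. *)

Definition label_step (n : nat) (lab : nat -> option 'Z_n) (e : nat * nat) :
    nat -> option 'Z_n :=
  let: (u, v) := e in
  if lab v is Some _ then lab
  else fun w => if w == v then omap (fun c => c + 1) (lab u) else lab w.

Definition gamma_label (n r : nat) : nat -> option 'Z_n :=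
  foldl (@label_step n) (fun v => if v == 1%N then Some 0 else None)
    (gamma_edges n r).

(* When 3 <= n and 1 <= r every vertex is reached, so the default value of    *)
(* [odflt] plays no role.                                                     *)
Definition layer_of (n r : nat) (v : vertex n r) : 'Z_n :=
  odflt 0 (gamma_label n r v.+1).

Definition layer (n r : nat) (c : 'Z_n) : {set vertex n r} :=
  [set v | layer_of v == c].

(* [enum] lists both 'Z_n and each layer in increasing order. *)
Definition layer_listing (n r : nat) : seq (vertex n r) :=
  flatten [seq enum (layer r c) | c <- enum 'Z_n].

Lemma sum_card_layer (n r : nat) :
  (\sum_(c : 'Z_n) #|layer r c|)%N = (r * n - 2 * r + 2)%N.
Proof.
rewrite -[RHS]card_ord -sum1_card (partition_big (@layer_of n r) xpredT) //=.
by apply: eq_bigr => c _; rewrite -sum1_card; apply: eq_bigl => v; rewrite inE.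
Qed.

Lemma size_layer_listing (n r : nat) :
  size (layer_listing n r) == (r * n - 2 * r + 2)%N.
Proof.
rewrite size_flatten /shape -map_comp sumnE big_map big_enum /=.
under eq_bigr do rewrite -cardE.
by apply/eqP/sum_card_layer.
Qed.

Lemma mem_layer_listing (n r : nat) (v : vertex n r) :
  v \in layer_listing n r.
Proof.
apply/flatten_mapP; exists (layer_of v); first by rewrite mem_enum.
by rewrite mem_enum inE.
Qed.

Lemma layer_listing_inj (n r : nat) :
  injective (tnth (Tuple (size_layer_listing n r))).
Proof.
apply/tuple_uniqP/card_uniqP; rewrite (eqP (size_layer_listing n r)).
rewrite -[RHS]card_ord; apply: eq_card => v.
by rewrite mem_layer_listing.
Qed.

(* Position i is sent to the i-th vertex of the listing; in [perm_mx s] the   *)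
(* only nonzero entry of row i is in column s i.                              *)
Definition layer_perm (n r : nat) : 'S_(r * n - 2 * r + 2) :=
  perm (@layer_listing_inj n r).

Definition layer_perm_mx (n r : nat) : 'M[int]_(r * n - 2 * r + 2) :=
  perm_mx (layer_perm n r).

Definition layered_adj (n r : nat) : 'M[int]_(r * n - 2 * r + 2) :=
  layer_perm_mx n r *m gamma_adj n r *m invmx (layer_perm_mx n r).

(* The matrix B^(c) of the block form is [layer_block r c (c + 1)]. *)
Definition layer_block (n r : nat) (c d : 'Z_n) :
    'M[int]_(#|layer r c|, #|layer r d|) :=
  \matrix_(i, j) (gamma_edge (enum_val i) (enum_val j))%:R.

(* Main.v *)
Require Import Defs.
From HB Require Import structures.
From mathcomp Require Import all_boot all_order all_algebra all_fingroup.
From mathcomp Require Import zify.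

Set Implicit Arguments.
Unset Strict Implicit.
Unset Printing Implicit Defensive.

Import GRing.Theory.
Local Open Scope ring_scope.

(** The block form says that every edge goes from a layer to the next one,
    i.e. that the labels grow by one modulo [n] along every edge. The graph is
    an [n]-cycle to which directed ears of length [n - 1] are attached one after
    the other. An edge that discovers its terminal vertex makes the label grow
    by one by definition, so only the closing edges of the cycle and of the ears
    need a reason. The cycle closes after [n] steps. Each ear, together with the
    closing edge of the ear (or of the cycle) before it, forms a directed
    [n]-cycle: around it all edges but the new closing one are already known to
    add one, hence so does that one.

    To make this precise, note that the vertices are discovered in increasing
    order. The recursive labelling after one more ear is therefore a fixed
    function of the vertex, cut off at the largest vertex discovered so far
    ([gamma_label_layer_index]). This function has the closed formula
    [layer_index], and it grows by one along every edge
    ([gamma_edges_advances]). Together they give [layer_of_edge].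

    What remains is bookkeeping: the [i]-th vertex of the concatenated listing
    of the layers is the one that the block decomposition of the index [i]
    points to ([layer_permE]), and therefore a nonzero entry of the reordered
    matrix outside the blocks [(c, c + 1)] would be an edge whose ends do not
    lie in consecutive layers. *)

(** The ear number [i] discovers the vertices above [junction n i.+1] up to
    [junction n i.+2] and closes at [junction n i.+1]. For positive [i] it
    departs from [junction n i]; [junction n 0 = 2] only starts the arithmetic
    progression. *)
Definition junction (n i : nat) : nat := (i * (n - 2) + 2)%N.

(** Along an ear the label follows the vertex number. The vertex numbered just
    after the last vertex [w] of the cycle or of an ear is the second vertex of
    an ear that starts at the successor of [w], so that its label is that of [w]
    plus 2, not plus 1. Hence the correction [(v - 3) %/ (n - 2)], which grows
    by one from an ear to the next; truncated subtraction makes it vanish on the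
    whole initial cycle. *)
Definition layer_index (n v : nat) : 'Z_n := (v.-1 + (v - 3) %/ (n - 2))%:R.

Definition advances (n : nat) (e : nat * nat) : bool :=
  layer_index n e.2 == layer_index n e.1 + 1.

Definition path_edges (a b : nat) : seq (nat * nat) :=
  [seq (j, j.+1) | j <- index_iota a b].

Definition ear_edges (n i : nat) : seq (nat * nat) :=
  ((if i == 0 then 1 else junction n i), (junction n i.+1).+1)%N
    :: path_edges (junction n i.+1).+1 (junction n i.+2)
    ++ [:: (junction n i.+2, junction n i.+1)].

Lemma gamma_edges1 (n : nat) :
  gamma_edges n 1 = path_edges 1 n ++ [:: (n, 1)%N].
Proof. by rewrite /gamma_edges /= cats0. Qed.

Lemma edges2E (n : nat) : (3 <= n)%N -> edges2 n = ear_edges n 0.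
Proof.
move=> hn; rewrite /edges2 /ear_edges /path_edges /junction /=.
by congr ((_, _) :: [seq _ | j <- index_iota _ _] ++ [:: (_, _)]); lia.
Qed.

Lemma edgesFE (n i : nat) :
  (3 <= n)%N -> (0 < i)%N -> edgesF n i = ear_edges n i.
Proof.
move=> hn hi; rewrite /edgesF /ear_edges /path_edges /junction /=.
rewrite (gtn_eqF hi).
by congr ((_, _) :: [seq _ | j <- index_iota _ _] ++ [:: (_, _)]); nia.
Qed.

(** This allows induction on [r]: one more step of the construction
    appends one ear. *)
Lemma gamma_edgesS (n r : nat) : (3 <= n)%N ->
  gamma_edges n r.+2 = gamma_edges n r.+1 ++ ear_edges n r.
Proof.
move=> hn; case: r => [|r]; first by rewrite -edges2E // /gamma_edges /= !cats0.
have iotaS :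
    index_iota 1 (r.+3 - 2).+1 = index_iota 1 (r.+2 - 2).+1 ++ [:: r.+1].
  by have := iotaD 1 r 1; rewrite addn1 add1n /index_iota !subSS !subn0.
rewrite /gamma_edges iotaS map_cat flatten_cat -edgesFE //.
by rewrite [flatten [seq _ | i <- [:: r.+1]]]cats0 !catA.
Qed.

Lemma layer_index_run (n i v : nat) :
  (i * (n - 2) <= v - 3 < i.+1 * (n - 2))%N ->
  layer_index n v = (v.-1 + i)%:R.
Proof.
move=> hv; rewrite /layer_index; suff -> : ((v - 3) %/ (n - 2) = i)%N by [].
have hd : (0 < n - 2)%N by nia.
by apply/eqP; rewrite eqn_leq -ltnS ltn_divLR // leq_divRL // andbC.
Qed.

Lemma path_advances (n i a b : nat) :
  (0 < a)%N -> (i * (n - 2) <= a - 3)%N -> (b - 3 < i.+1 * (n - 2))%N ->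
  all (advances n) (path_edges a b).
Proof.
move=> a_gt0 ha hb; apply/allP => e /mapP[j]; rewrite mem_index_iota => hj ->.
rewrite /advances /= !(@layer_index_run n i); try lia.
by rewrite natr1; apply/eqP; congr (_%:R); lia.
Qed.

(** For the edges that open or close an ear and for the closing edge of the
    cycle, natural representatives of the labels grow by one only up to a
    multiple of [n]. *)
Lemma advances_modn (n u v k l : nat) : (1 < n)%N ->
  layer_index n u = k%:R -> layer_index n v = l%:R ->
  (l == k.+1 %[mod n])%N -> advances n (u, v).
Proof.
move=> hn hu hv /eqP hkl; rewrite /advances /= hu hv natr1.
by rewrite -Zp_nat_mod // hkl Zp_nat_mod.
Qed.

(** In [layer_index], the opening edge raises the vertex number by [n - 1] and
    the correction by 2 (by [n] and 1 for the first ear), so the total by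
    [n + 1]; the closing edge lowers the number by [n - 2] and the correction by
    1, so the total by [n - 1]. Both amount to 1 modulo [n]. *)
Lemma ear_advances (n i : nat) : (3 <= n)%N -> all (advances n) (ear_edges n i).
Proof.
move=> hn; rewrite /= all_cat /= andbT; apply/and3P; split.
- case: (posnP i) => [->|hi].
    apply: (@advances_modn _ _ _ 0 n.+1).
    + lia.
    + by rewrite (@layer_index_run n 0) //; lia.
    + rewrite (@layer_index_run n 1) /junction; last by lia.
      by congr (_%:R); lia.
    + by rewrite -addn1 modnDl.
  apply: (@advances_modn _ _ _ (i * (n - 1)) (i * (n - 1) + n.+1)).
  + lia.
  + rewrite (@layer_index_run n i.-1) /junction; last by nia.
    by congr (_%:R); nia.
  + rewrite (@layer_index_run n i.+1) /junction; last by nia.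
    by congr (_%:R); nia.
  + by rewrite -addSnnS modnDr.
- by apply: (@path_advances n i.+1); rewrite /junction; nia.
- apply: (@advances_modn _ _ _ (i.+1 * (n - 1) + n.-1) (i.+1 * (n - 1))).
  + lia.
  + rewrite (@layer_index_run n i.+1) /junction; last by nia.
    by congr (_%:R); nia.
  + rewrite (@layer_index_run n i) /junction; last by nia.
    by congr (_%:R); nia.
  + by rewrite -addnS prednK ?modnDr //; lia.
Qed.

(** The labelling in its course: since vertices are discovered in increasing
    order, the state reached so far is determined by the number [m] of
    discovered vertices. Giving the undiscovered vertices explicitly makes the
    state exact, which is what decides the branch taken by [label_step]. *)
Definition labelled (n m : nat) (lab : nat -> option 'Z_n) : Prop :=
  forall w, lab w = if (0 < w <= m)%N then Some (layer_index n w) else None.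

Lemma labelled_new (n m u : nat) (lab : nat -> option 'Z_n) :
  labelled m lab -> (0 < u <= m)%N -> advances n (u, m.+1) ->
  labelled m.+1 (label_step lab (u, m.+1)).
Proof.
move=> hlab hu /eqP /= hadv w; rewrite /label_step hlab ltnn /= hlab hu /=.
have [->|hw] := eqVneq w m.+1; first by rewrite leqnn -hadv.
by rewrite hlab; congr (if _ then _ else _); lia.
Qed.

Lemma labelled_old (n m u v : nat) (lab : nat -> option 'Z_n) :
  labelled m lab -> (0 < v <= m)%N -> labelled m (label_step lab (u, v)).
Proof. by move=> hlab hv; rewrite /label_step hlab hv. Qed.

Lemma labelled_path (n a b : nat) (lab : nat -> option 'Z_n) :
  (0 < a <= b)%N -> all (advances n) (path_edges a b) -> labelled a lab ->
  labelled b (foldl (@label_step n) lab (path_edges a b)).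
Proof.
rewrite /path_edges /index_iota => /andP[a_gt0 /subnKC <-]; rewrite addKn.
move: (b - a)%N => k {b}.
elim: k a lab a_gt0 => [|k IHk] a lab a_gt0 /=; first by rewrite addn0.
case/andP=> hadv hall hlab; rewrite -addSnnS; apply: IHk => //.
by apply: labelled_new hadv => //; rewrite a_gt0 /=.
Qed.

Lemma gamma_edges_advances (n r : nat) : (3 <= n)%N ->
  all (advances n) (gamma_edges n r.+1).
Proof.
move=> hn; elim: r => [|r IHr].
  rewrite gamma_edges1 all_cat (@path_advances n 0) //=; try lia.
  rewrite andbT; apply: (@advances_modn _ _ _ n.-1 0).
  - lia.
  - by rewrite (@layer_index_run n 0) ?addn0 //; lia.
  - by rewrite (@layer_index_run n 0) //; lia.
  - by rewrite prednK ?modnn ?mod0n //; lia.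
by rewrite gamma_edgesS // all_cat IHr ear_advances.
Qed.

Lemma gamma_label_layer_index (n r : nat) : (3 <= n)%N ->
  labelled (junction n r.+1) (gamma_label n r.+1).
Proof.
move=> hn; rewrite /gamma_label.
elim: r => [|r IHr].
  have := gamma_edges_advances 0 hn.
  rewrite gamma_edges1 all_cat foldl_cat /= => /andP[hpath _].
  have -> : junction n 1 = n by rewrite /junction; lia.
  apply: labelled_old; last by lia.
  apply: labelled_path => //; first by lia.
  by case=> [|[|w]] //=; rewrite /layer_index div0n.
have := ear_advances r hn; rewrite gamma_edgesS // foldl_cat /ear_edges.
move: (foldl _ _ (gamma_edges _ _)) IHr => lab hlab.
rewrite /= all_cat foldl_cat => /and3P[hfirst hpath _].
apply: labelled_old; last by rewrite /junction; nia.
apply: labelled_path => //; first by rewrite /junction; nia.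
apply: labelled_new => //.
by case: ifP => _; rewrite /junction; nia.
Qed.

(** The layers grade the graph; this is what annihilates the blocks [(c, d)]
    with [d != c + 1]. *)
Lemma layer_of_edge (n r : nat) (u v : vertex n r) : (3 <= n)%N -> (1 <= r)%N ->
  gamma_edge u v -> layer_of v = layer_of u + 1.
Proof.
move=> hn; case: r u v => // r u v _.
have layerE (w : vertex n r.+1) : layer_of w = layer_index n w.+1.
  rewrite /layer_of gamma_label_layer_index // ifT //.
  by have := ltn_ord w; rewrite /junction; nia.
by move=> /(allP (gamma_edges_advances r hn)) /eqP; rewrite !layerE.
Qed.

(** Position [Rank c j] counts the elements of all earlier sets plus [j], which
    is where concatenation puts the [j]-th element of [A c]. *)
Lemma nth_flatten_enum (T : finType) (m : nat) (A : 'I_m -> {set T}) (x0 : T)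
    (c : 'I_m) (j : 'I_#|A c|) :
  nth x0 (flatten [seq enum (A d) | d <- enum 'I_m])
      (tagnat.Rank c j : 'I_(\sum_d #|A d|)) = enum_val j.
Proof.
set ss := [seq enum (A d) | d <- enum 'I_m].
have nth_ss : nth [::] ss c = enum (A c).
  by rewrite (nth_map c) ?size_enum_ord // nth_ord_enum.
have lt_j : (j < nth 0 (shape ss) c)%N.
  rewrite (nth_map [::]) ?nth_ss -?cardE //.
  by rewrite size_map size_enum_ord.
have -> : (tagnat.Rank c j : 'I_(\sum_d #|A d|)) =
          flatten_index (shape ss) c j :> nat.
  rewrite tagnat.RankEsum /flatten_index; congr (_ + _)%N.
  rewrite /shape -map_comp -map_take sumnE big_map.
  (* The rank sums over indices below c, the flattening over a prefix. *)
  have -> : take c (enum 'I_m) = [seq k : 'I_m <- enum 'I_m | (k < c)%N].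
    apply: (inj_map val_inj); rewrite map_take val_enum_ord.
    rewrite -(filter_map val (fun k => k < c)%N) val_enum_ord.
    by rewrite take_iota (minn_idPl _) ?(@filter_iota_ltn 0) // ltnW.
  rewrite big_filter big_enum_cond /=.
  by apply: eq_bigr => k _; rewrite cardE.
rewrite nth_flatten flatten_indexKl // flatten_indexKr // nth_ss.
by rewrite (enum_val_nth x0).
Qed.

Lemma layer_permE (n r : nat) (p : 'I_(\sum_(c : 'Z_n) #|layer r c|)) :
  layer_perm n r (cast_ord (sum_card_layer n r) p) = enum_val (tagnat.sig2 p).
Proof.
rewrite permE; set x0 : vertex n r := enum_val _.
by rewrite (tnth_nth x0) {2}/x0 -(nth_flatten_enum x0) tagnat.sig2K.
Qed.

Lemma layer_of_enum_val (n r : nat) (c : 'Z_n) (i : 'I_#|layer r c|) :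
  layer_of (enum_val i) = c.
Proof. by have := enum_valP i; rewrite inE => /eqP. Qed.

Lemma layered_adjE (n r : nat) i j :
  layered_adj n r i j = (gamma_edge (layer_perm n r i) (layer_perm n r j))%:R.
Proof.
have invP : invmx (layer_perm_mx n r) = perm_mx (layer_perm n r)^-1.
  apply: (can_inj (mulKmx (unitmx_perm _ (layer_perm n r)))).
  by rewrite mulmxV ?unitmx_perm // -perm_mxM mulgV perm_mx1.
by rewrite /layered_adj invP -row_permE -col_permE !mxE.
Qed.

Theorem proposition2p4 (n r : nat) (hn : (3 <= n)%N) (hr : (1 <= r)%N) :
  layered_adj n r =
  castmx (sum_card_layer n r, sum_card_layer n r)
    (\mxblock_(c, d) (if d == c + 1 then layer_block r c d else 0)).
Proof.
apply/matrixP => i j; rewrite layered_adjE castmxE mxE.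
set p := cast_ord _ i; set q := cast_ord _ j.
have -> : i = cast_ord (sum_card_layer n r) p by rewrite cast_ordKV.
have -> : j = cast_ord (sum_card_layer n r) q by rewrite cast_ordKV.
rewrite !layer_permE; case: ifPn => hpq; rewrite mxE //.
case: (boolP (gamma_edge _ _)) => // /(layer_of_edge hn hr).
by rewrite !layer_of_enum_val => eq_pq; rewrite eq_pq eqxx in hpq.
Qed.
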